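(* Let $n,m,k\ge1$, let $A_1,\dots,A_k\in\mathscr{P}_n(\mathbb{C})$, $B_1,\dots,B_k\in\mathscr{P}_m(\mathbb{H})$, and let $w_1,\dots,w_k>0$ satisfy $\sum_{j=1}^kw_j=1$. Then $$\Psi_1\left(\mathrm{Bar}^w_{\log,\mathbb{C}}(A_1,\dots,A_k)\right)=\mathrm{Bar}^w_{\log,\mathbb{R}}\left(\Psi_1(A_1),\dots,\Psi_1(A_k)\right)$$ and $$\Psi_2\left(\mathrm{Bar}^w_{\log,\mathbb{H}}(B_1,\dots,B_k)\right)=\mathrm{Bar}^w_{\log,\mathbb{C}}\left(\Psi_2(B_1),\dots,\Psi_2(B_k)\right).$$
   Context: For $\mathbb{D}\in\{\mathbb{R},\mathbb{C},\mathbb{H}\}$, $A^*$ is the conjugate transpose of $A\in\mathrm{Mat}_n(\mathbb{D})$, $\mathfrak{p}_n(\mathbb{D})=\{A\in\mathrm{Mat}_n(\mathbb{D}):A=A^*\}$, and $\mathscr{P}_n(\mathbb{D})$ is the set of $A\in\mathfrak{p}_n(\mathbb{D})$ with $x^*Ax>0$ for all nonzero $x\in\mathbb{D}^n$. The exponential series gives a bijection $\exp_{\mathbb{D}}:\mathfrak{p}_n(\mathbb{D})\to\mathscr{P}_n(\mathbb{D})$, with inverse $\log_{\mathbb{D}}$. For $w_1,\dots,w_k>0$ with $\sum_jw_j=1$, the weighted Log-Euclidean barycentre of $A_1,\dots,A_k\in\mathscr{P}_n(\mathbb{D})$ is $$\mathrm{Bar}^w_{\log,\mathbb{D}}(A_1,\dots,A_k)=\exp_{\mathbb{D}}\left(\sum_{j=1}^kw_j\log_{\mathbb{D}}(A_j)\right).$$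 The maps $\Psi_1:\mathrm{Mat}_n(\mathbb{C})\to\mathrm{Mat}_{2n}(\mathbb{R})$ and $\Psi_2:\mathrm{Mat}_m(\mathbb{H})\to\mathrm{Mat}_{2m}(\mathbb{C})$ are $\Psi_1(A+iB)=\begin{pmatrix}A&B\\-B&A\end{pmatrix}$ ($A,B\in\mathrm{Mat}_n(\mathbb{R})$) and $\Psi_2(Z_1+Z_2j)=\begin{pmatrix}Z_1&Z_2\\-\overline{Z_2}&\overline{Z_1}\end{pmatrix}$ ($Z_1,Z_2\in\mathrm{Mat}_m(\mathbb{C})$, using $\mathbb{H}=\mathbb{C}\oplus\mathbb{C}j$). They map $\mathscr{P}_n(\mathbb{C})$ into $\mathscr{P}_{2n}(\mathbb{R})$ and $\mathscr{P}_m(\mathbb{H})$ into $\mathscr{P}_{2m}(\mathbb{C})$. *)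

(* Defs.v *)
From HB Require Import structures.
From mathcomp Require Export all_boot all_order all_algebra.
From mathcomp Require Export all_classical all_reals all_analysis.
From mathcomp Require Export complex.
From mathcomp Require Import ring.
Export numFieldNormedType.Exports.
Export Order.TTheory GRing.Theory Num.Theory.

Set Implicit Arguments.
Unset Strict Implicit.
Unset Printing Implicit Defensive.

Local Open Scope classical_set_scope.
Local Open Scope complex_scope.
Local Open Scope ring_scope.

(* The topology of R[i] is the one of its modulus; MathComp-Analysis only
   attaches it to abstract numFieldTypes. *)
HB.instance Definition _ (R : realType) := NormedModule.copy R[i] R[i]^o.

(* The pair (a, b) of complex numbers stands for the quaternion a + b j, where
   j ^ 2 = -1 and j z = z^* j for z complex. *)
Definition quaternion (R : realType) : Type := (R[i] * R[i])%type.

Section Quaternion.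
Variable R : realType.
Local Notation H := (quaternion R).

HB.instance Definition _ := GRing.Zmodule.copy H (R[i] * R[i])%type.
HB.instance Definition _ := PseudoMetric.copy H (R[i] * R[i])%type.

Definition quat_one : H := (1, 0).
Definition quat_mul (x y : H) : H :=
  (x.1 * y.1 - x.2 * conjc y.2, x.1 * y.2 + x.2 * conjc y.1).
Definition quat_conj (x : H) : H := (conjc x.1, - x.2).
Definition quat_of_real (r : R) : H := (r%:C, 0).

Lemma quat_mulA : associative quat_mul.
Proof.
move=> [a b] [c d] [e f]; rewrite /quat_mul /=.
by rewrite !(rmorphB, rmorphD, rmorphM) /= !conjcK; congr pair; ring.
Qed.

Lemma quat_mul1l : left_id quat_one quat_mul.
Proof. by move=> [a b]; rewrite /quat_mul /= !mul1r !mul0r subr0 addr0. Qed.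

Lemma quat_mul1r : right_id quat_one quat_mul.
Proof.
move=> [a b]; rewrite /quat_mul.
have -> : conjc quat_one.1 = 1 by apply: rmorph1.
have -> : conjc quat_one.2 = 0 by apply: rmorph0.
by rewrite /= !mulr1 !mulr0 subr0 add0r.
Qed.

Lemma quat_mulDl : left_distributive quat_mul +%R.
Proof. by move=> [a b] [c d] [e f]; congr pair => /=; ring. Qed.

Lemma quat_mulDr : right_distributive quat_mul +%R.
Proof.
move=> [a b] [c d] [e f]; rewrite /quat_mul /= !rmorphD /=.
by congr pair => /=; ring.
Qed.

Lemma quat_one_neq0 : quat_one != 0.
Proof. by apply/eqP => -[] /eqP; rewrite oner_eq0. Qed.

HB.instance Definition _ := GRing.Zmodule_isNzRing.Build H
  quat_mulA quat_mul1l quat_mul1r quat_mulDl quat_mulDr quat_one_neq0.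

End Quaternion.

(* Common interface of the reals, the complex numbers and the quaternions: a
   topological ring with a conjugation and an embedding of the reals. *)
HB.mixin Record hasConjReal (R : realType) (D : Type) := {
  conjD : D -> D;
  realD : R -> D }.

#[short(type="conjRingType")]
HB.structure Definition ConjRing (R : realType) :=
  {D of GRing.NzRing D & Topological D & hasConjReal R D}.

#[non_forgetful_inheritance]
HB.instance Definition _ (R : realType) := hasConjReal.Build R R idfun idfun.
HB.instance Definition _ (R : realType) :=
  hasConjReal.Build R R[i] (@conjc R) (@real_complex R).
HB.instance Definition _ (R : realType) :=
  hasConjReal.Build R (quaternion R) (@quat_conj R) (@quat_of_real R).

Section LogEuclidean.
Variables (R : realType) (D : conjRingType R).

Definition ctrmx m n (A : 'M[D]_(m, n)) : 'M[D]_(n, m) :=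
  map_mx (@conjD R D) A^T.

Definition selfadjoint n : set 'M[D]_n := [set A | A = ctrmx A].

(* For A selfadjoint, x^* A x is a real scalar. *)
Definition posdef n : set 'M[D]_n :=
  [set A | selfadjoint A /\ forall x : 'cV[D]_n, x != 0 ->
    exists2 r : R, 0 < r & ctrmx x *m A *m x = (realD r)%:M].

(* The sum of the exponential series; lim is not available here because D is
   not required to be pointed. *)
Definition mxexp n (A : 'M[D]_n) : 'M[D]_n :=
  let term : nat -> 'M[D]_n := fun i => realD (i`!%:R^-1) *: A ^+ i in
  xget 0 [set E : 'M[D]_n | series term @ \oo --> E].

(* The inverse of the exponential on selfadjoint matrices; it is extended by 0
   outside of the image of the latter. *)
Definition mxlog n : 'M[D]_n -> 'M[D]_n :=
  'pinv_(fun=> 0) (@selfadjoint n) (@mxexp n).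

Definition log_bar n k (w : 'I_k -> R) (A : 'I_k -> 'M[D]_n) : 'M[D]_n :=
  mxexp (\sum_(j < k) realD (w j) *: mxlog (A j)).

End LogEuclidean.

Arguments selfadjoint {R} D n.
Arguments posdef {R} D n.

Section Embeddings.
Variable R : realType.

Definition Psi1 n (A : 'M[R[i]]_n) : 'M[R]_(n + n) :=
  let X := map_mx (@complex.Re R) A in
  let Y := map_mx (@complex.Im R) A in
  block_mx X Y (- Y) X.

Definition Psi2 m (A : 'M[quaternion R]_m) : 'M[R[i]]_(m + m) :=
  let Z1 := map_mx (fun q : quaternion R => q.1) A in
  let Z2 := map_mx (fun q : quaternion R => q.2) A in
  block_mx Z1 Z2 (- map_mx (@conjc R) Z2) (map_mx (@conjc R) Z1).

End Embeddings.

(* Main.v *)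
Require Import Defs.
From mathcomp Require Import sesquilinear spectral.

(** Both maps Psi are injective homomorphisms of real algebras that commute
    with the conjugate transpose, and they are homeomorphisms onto their
    images because a continuous left inverse can be read off the upper blocks.
    Such a map [f] carries the partial sums of the exponential series of [X] to
    those of [f X], and one series converges if and only if the other does;
    hence [mxexp (f X) = f (mxexp X)] for every [X], without any convergence
    estimate ([mxexp_embedding]).

    For the logarithm the point is that the exponential is injective on
    selfadjoint matrices.  Over the complex numbers, write X and Y in
    diagonal form, X = P^-1 D P and Y = Q^-1 E Q with D and E real.  If
    exp X = exp Y then W = P Q^-1 satisfies exp(D) W = W exp(E); comparing
    entries, W_ij <> 0 forces D_i = E_j, so D W = W E and X = Y
    ([mxexp_injective_complex]).  The real case follows by extending scalars.
    Injectivity gives log (f A) = f (log A) when A is the exponential of a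
    selfadjoint matrix.

    When A is not such an exponential, both logarithms are 0 by convention, as
    soon as f A is not an exponential either.  To see this, the image of
    f is described as the fixed points of an involutive automorphism t
    of the target algebra: if Y is selfadjoint and exp Y = f A, then
    exp (t Y) = t (f A) = f A, so t Y = Y by injectivity, hence Y = f X and
    exp X = A ([mxlog_embedding]).

    The two statements are instances of one: the complex numbers over the
    reals, and the quaternions over the complex numbers, are Cayley-Dickson
    doublings, and Psi is the block form of a matrix over the double
    ([doubling]). *)

Set Implicit Arguments.
Unset Strict Implicit.
Unset Printing Implicit Defensive.

Local Open Scope classical_set_scope.
Local Open Scope complex_scope.
Local Open Scope ring_scope.

(** * Topology of matrices *)

Lemma cvg_mx (D : topologicalType) T (F : set_system T) (FF : Filter F) p q
    (f : T -> 'M[D]_(p, q)) (M : 'M[D]_(p, q)) :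
  (forall i j, (fun t => f t i j) @ F --> M i j) -> f @ F --> M.
Proof.
move=> cvf A [P nbhsP sPA].
suff : \forall t \near F, forall i j, P i j (f t i j).
  by apply: filterS => t Pt; apply: sPA.
by do 2!apply: filter_forall => ?; apply: cvf; apply: nbhsP.
Qed.

Lemma continuous_mx (T D : topologicalType) p q (f : T -> 'M[D]_(p, q)) :
  (forall i j, continuous (fun t => f t i j)) -> continuous f.
Proof. by move=> cf t; apply: (@cvg_mx _ _ (nbhs t)) => i j; apply: cf. Qed.

Lemma continuous_entry (D : topologicalType) p q i j :
  continuous (fun M : 'M[D]_(p, q) => M i j).
Proof.
move=> M A nbhsA; exists (fun k l => [set x | k = i -> l = j -> A x]).
  move=> k l; have [ki|/eqP ki] := eqVneq k i; last by apply: nearW => x /ki.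
  have [lj|/eqP lj] := eqVneq l j; last by apply: nearW => x _ /lj.
  by rewrite ki lj; apply: filterS nbhsA => x Ax.
by move=> N /(_ i j) AN; apply: (AN erefl erefl).
Qed.

Lemma cvg_mx_unique (D : topologicalType) p q (F : set_system 'M[D]_(p, q))
    (FF : ProperFilter F) :
  hausdorff_space D -> is_subset1 [set M : 'M[D]_(p, q) | F --> M].
Proof.
move=> hD M N FM FN; apply/matrixP => i j.
have cvij (L : 'M[D]_(p, q)) : F --> L -> L' i j @[L' --> F] --> L i j.
  by move=> FL; exact: (cvg_comp id _ FL (@continuous_entry D p q i j L)).
exact: (cvg_unique hD (cvij M FM) (cvij N FN)).
Qed.

Section MatrixContinuity.
Variables (T D E : topologicalType).

Lemma continuous_map_mx (h : D -> E) p q (f : T -> 'M[D]_(p, q)) :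
  continuous h -> continuous f -> continuous (fun t => map_mx h (f t)).
Proof.
move=> ch cf; apply: continuous_mx => i j; under eq_fun do rewrite mxE.
move=> t.
have cfij : f t' i j @[t' --> t] --> f t i j.
  exact: (continuous_cvg _ (@continuous_entry _ _ _ i j _) (cf t)).
exact: (continuous_cvg _ (ch _) cfij).
Qed.

Lemma continuous_block_mx m1 m2 n1 n2
    (ul : T -> 'M[D]_(m1, n1)) (ur : T -> 'M[D]_(m1, n2))
    (dl : T -> 'M[D]_(m2, n1)) (dr : T -> 'M[D]_(m2, n2)) :
  continuous ul -> continuous ur -> continuous dl -> continuous dr ->
  continuous (fun t => block_mx (ul t) (ur t) (dl t) (dr t)).
Proof.
have entry p q (f : T -> 'M[D]_(p, q)) i j :
    continuous f -> continuous (fun t => f t i j).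
  by move=> cf t;
     exact: (continuous_cvg _ (@continuous_entry _ _ _ i j _) (cf t)).
move=> cul cur cdl cdr; apply: continuous_mx => i j.
rewrite -(splitK i) -(splitK j).
case: (fintype.split i) => i'; case: (fintype.split j) => j' /=.
- by under eq_fun do rewrite block_mxEul; apply: entry.
- by under eq_fun do rewrite block_mxEur; apply: entry.
- by under eq_fun do rewrite block_mxEdl; apply: entry.
- by under eq_fun do rewrite block_mxEdr; apply: entry.
Qed.

Lemma continuous_submx n :
  [/\ continuous (@ulsubmx D n n n n), continuous (@ursubmx D n n n n),
      continuous (@dlsubmx D n n n n) & continuous (@drsubmx D n n n n)].
Proof.
split; apply: continuous_mx => i j; under eq_fun do rewrite !mxE;
  exact: continuous_entry.
Qed.

End MatrixContinuity.

(** * Exponential and logarithm under an embedding of real algebras *)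

(** The continuous left inverse [g] makes [f] a homeomorphism onto its image,
    so that convergence can be transported in both directions. *)
Record real_embedding (R : realType) (D E : conjRingType R) n p
    (f : 'M[D]_n -> 'M[E]_p) (g : 'M[E]_p -> 'M[D]_n) : Prop := RealEmbedding {
  embK : cancel f g;
  emb_continuous : continuous f;
  embV_continuous : continuous g;
  embD : {morph f : X Y / X + Y};
  emb1 : f 1%:M = 1%:M;
  embM : {morph f : X Y / X *m Y};
  embZ : forall r X, f (realD r *: X) = realD r *: f X }.

Arguments emb_continuous {R D E n p f g} fg x : rename.
Arguments embV_continuous {R D E n p f g} fg x : rename.

Section Exponential.
Variables (R : realType) (D E : conjRingType R) (n p : nat).
Variables (f : 'M[D]_n -> 'M[E]_p) (g : 'M[E]_p -> 'M[D]_n).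
Hypothesis fg : real_embedding f g.

Lemma emb0 : f 0 = 0.
Proof. by apply: (addrI (f 0)); rewrite -(embD fg) !addr0. Qed.

Lemma emb_sum I (r : seq I) (F : I -> 'M[D]_n) :
  f (\sum_(i <- r) F i) = \sum_(i <- r) f (F i).
Proof. exact: (big_morph _ (embD fg) emb0). Qed.

Lemma embX X i : f (X ^+ i) = f X ^+ i.
Proof.
by elim: i => [|i IH]; rewrite ?expr0 ?(emb1 fg) // !exprS (embM fg) IH.
Qed.

(** When the series of [X] diverges, so does the one of [f X], since [g] would
    carry a limit back; both sides are then 0. *)
Lemma mxexp_embedding :
  hausdorff_space E -> forall X, mxexp (f X) = f (mxexp X).
Proof.
move=> hE X; rewrite /mxexp.
set s := series (fun i => _ *: X ^+ i).
have -> : series (fun i => realD (i`!%:R^-1) *: f X ^+ i) = f \o s.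
  apply/funext => N; rewrite /series /= emb_sum.
  by apply: eq_bigr => i _; rewrite (embZ fg) embX.
have [[L sL]|noL] := pselect (exists L : 'M[D]_n, s @ \oo --> L).
  have /= cvs := xgetPex 0 (ex_intro (fun L : 'M[D]_n => s @ \oo --> L) L sL).
  have ufs : is_subset1 [set M : 'M[E]_p | f \o s @ \oo --> M].
    exact: cvg_mx_unique.
  apply: (xget_subset1 _ _ ufs).
  exact: (continuous_cvg _ (emb_continuous fg _) cvs).
rewrite !xgetPN ?emb0 // => L /=.
  by move=> sL; apply: noL; exists L.
move=> fsL; apply: noL; exists (g L).
have -> : s = g \o (f \o s) by apply/funext => N /=; rewrite (embK fg).
exact: (continuous_cvg _ (embV_continuous fg L) fsL).
Qed.

End Exponential.

Definition mxexp_injective (R : realType) (D : conjRingType R) n :=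
  {in selfadjoint D n &, injective (@mxexp R D n)}.

Lemma mxlogK (R : realType) (D : conjRingType R) n (X : 'M[D]_n) :
  mxexp_injective D n -> selfadjoint D n X -> mxlog (mxexp X) = X.
Proof. by move=> inj sX; apply: pinvKV => //; rewrite inE. Qed.

Lemma mxlog_out (R : realType) (D : conjRingType R) n (A : 'M[D]_n) :
  (forall X, selfadjoint D n X -> mxexp X <> A) -> mxlog A = 0.
Proof.
move=> nA; rewrite /mxlog /pinv_ splitV /= oinv_surj.
by case: pselect => // -[X sX XA]; case: (nA X sX).
Qed.

Lemma mxexp_injective_embedding (R : realType) (D E : conjRingType R) n p
    (f : 'M[D]_n -> 'M[E]_p) (g : 'M[E]_p -> 'M[D]_n) :
  hausdorff_space E -> real_embedding f g ->
  (forall X, f (ctrmx X) = ctrmx (f X)) ->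
  mxexp_injective E p -> mxexp_injective D n.
Proof.
move=> hE fg fct inj X Y; rewrite !inE => sX sY eXY.
apply: (can_inj (embK fg)); apply: inj.
- by rewrite inE /selfadjoint /= -fct -sX.
- by rewrite inE /selfadjoint /= -fct -sY.
- by rewrite !(mxexp_embedding fg) ?eXY.
Qed.

Section Logarithm.
Variables (R : realType) (D E : conjRingType R) (n p : nat).
Variables (f : 'M[D]_n -> 'M[E]_p) (g : 'M[E]_p -> 'M[D]_n).
Variable t : 'M[E]_p -> 'M[E]_p.
Hypothesis hE : hausdorff_space E.
Hypothesis fg : real_embedding f g.
Hypothesis fct : forall X, f (ctrmx X) = ctrmx (f X).
Hypothesis t_emb : real_embedding t t.
Hypothesis tct : forall Y, t (ctrmx Y) = ctrmx (t Y).
Hypothesis tf : forall X, t (f X) = f X.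
Hypothesis t_fix : forall Y, t Y = Y -> f (g Y) = Y.
Hypothesis inj : mxexp_injective E p.

(** If [f A] is the exponential of a selfadjoint [Y], injectivity makes [Y] a
    fixed point of [t], so [Y] comes from a logarithm of [A]: thus [A] and
    [f A] are in the domains of the respective logarithms together. *)
Lemma mxlog_embedding A : mxlog (f A) = f (mxlog A).
Proof.
have [[X sX XA]|nA] := pselect (exists2 X, selfadjoint D n X & mxexp X = A).
  rewrite -XA -(mxexp_embedding fg) // !mxlogK //.
    exact: (mxexp_injective_embedding hE fg).
  by rewrite /selfadjoint /= -fct -sX.
rewrite !mxlog_out ?(emb0 fg) // => [X sX XA|Y sY YfA].
  by apply: nA; exists X.
have tY : t Y = Y.
  apply: inj; rewrite ?inE //; first by rewrite /selfadjoint /= -tct -sY.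
  by rewrite (mxexp_embedding t_emb) // YfA tf.
apply: nA; exists (g Y).
  by apply: (can_inj (embK fg)); rewrite fct t_fix.
by apply: (can_inj (embK fg)); rewrite -(mxexp_embedding fg) // t_fix.
Qed.

Lemma log_bar_embedding k (w : 'I_k -> R) (A : 'I_k -> 'M[D]_n) :
  f (log_bar w A) = log_bar w (fun j => f (A j)).
Proof.
rewrite /log_bar -(mxexp_embedding fg) // (emb_sum fg); congr mxexp.
by apply: eq_bigr => j _; rewrite (embZ fg) mxlog_embedding.
Qed.

End Logarithm.

(** * Continuity of the complex coordinates *)

Lemma continuous_real_complex (R : realType) :
  continuous (real_complex R : R -> R[i]).
Proof.
move=> x; apply/cvgrPdist_lt => /= e e0.
have e0' : 0 < complex.Re e by move: e0; rewrite ltcE => /andP[].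
have eE : e = (complex.Re e)%:C by apply/esym/RRe_real/gtr0_real.
near=> y; rewrite eE -rmorphB normc_def /= expr0n /= addr0 sqrtr_sqr ltcR.
by near: y; apply: cvgr_dist_lt.
Unshelve. all: by end_near. Qed.

Lemma near_complex (R : realType) (z e : R[i]) :
  0 < e -> \forall y \near (z : R[i]), `|z - y| < e.
Proof. exact: (@cvgr_dist_lt R[i] R[i] _ (nbhs z) _ id z cvg_id). Qed.

Lemma continuous_Re (R : realType) : continuous (@complex.Re R : R[i] -> R).
Proof.
move=> z; apply/(@cvgrPdist_lt _ _ _ (nbhs (z : R[i]))) => e e0.
have e0' : 0 < e%:C :> R[i] by rewrite ltcR.
near=> y; rewrite -raddfB -ltcR; apply: le_lt_trans (normc_ge_Re _) _.
by near: y; apply: near_complex.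
Unshelve. all: by end_near. Qed.

Lemma continuous_conjc (R : realType) : continuous (@conjc R : R[i] -> R[i]).
Proof.
move=> z; apply/(@cvgrPdist_lt _ _ _ (nbhs (z : R[i]))) => e e0.
near=> y; rewrite -rmorphB /= normcJ.
by near: y; apply: near_complex.
Unshelve. all: by end_near. Qed.

Lemma continuous_Im (R : realType) : continuous (@complex.Im R : R[i] -> R).
Proof.
move=> z; apply/(@cvgrPdist_lt _ _ _ (nbhs (z : R[i]))) => e e0.
have e0' : 0 < e%:C :> R[i] by rewrite ltcR.
near=> y; rewrite -raddfB -normrN -ReiNIm -ltcR.
apply: le_lt_trans (normc_ge_Re _) _; rewrite normrM normCi mulr1.
by near: y; apply: near_complex.
Unshelve. all: by end_near. Qed.

Lemma continuous_Complex (R : realType) :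
  continuous (fun x : R * R => x.1 +i* x.2 : R[i]).
Proof.
have -> : (fun x : R * R => x.1 +i* x.2 : R[i]) =
          fun x => x.1%:C + 'i * x.2%:C.
  by apply/funext => -[a b]; simpc.
move=> x; apply: cvgD.
  by apply: (continuous_cvg _ (@continuous_real_complex R _)); exact: cvg_fst.
apply: (continuous_cvg _ (@mulrl_continuous R[i] _ _)).
by apply: (continuous_cvg _ (@continuous_real_complex R _)); exact: cvg_snd.
Qed.

(** * Injectivity of the exponential on selfadjoint matrices *)

Lemma similar_intertwine (F : fieldType) n (P Q D E : 'M[F]_n) :
  P \in unitmx -> Q \in unitmx ->
  invmx P *m D *m P = invmx Q *m E *m Q <->
  D *m (P *m invmx Q) = P *m invmx Q *m E.
Proof.
move=> uP uQ; split=> [|] DE.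
  have PDQ : invmx P *m (D *m (P *m invmx Q)) = invmx Q *m E.
    by rewrite !mulmxA DE mulmxK.
  by rewrite -[LHS](mulKVmx uP) PDQ mulmxA.
have PDQ : invmx P *m D *m P *m invmx Q = invmx Q *m E.
  by rewrite -!mulmxA DE -mulmxA mulKmx.
by rewrite -PDQ mulmxKV.
Qed.

Section Hermitian.
Variables (R : realType) (n : nat).
Implicit Types (X Y P : 'M[R[i]]_n) (d : 'rV[R]_n).

Let real_diag d : 'M[R[i]]_n := diag_mx (map_mx (real_complex R) d).

Lemma hausdorff_complex : hausdorff_space R[i].
Proof. exact: norm_hausdorff. Qed.

Lemma real_diagXn d k :
  real_diag d ^+ k = real_diag (map_mx (fun x => x ^+ k) d).
Proof.
elim: k => [|k IH].
  rewrite expr0 -[LHS]/(1%:M) -diag_const_mx; congr diag_mx.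
  by apply/rowP => j; rewrite !mxE.
rewrite exprS IH -[LHS]/(real_diag d *m _) mulmx_diag; congr diag_mx.
by apply/rowP => j; rewrite !mxE -rmorphM exprS.
Qed.

Lemma mxexp_diag d : mxexp (real_diag d) = real_diag (map_mx expR d).
Proof.
set u := fun k => (realD k`!%:R^-1 : R[i]) *: real_diag d ^+ k.
suff cvu : series u @ \oo --> real_diag (map_mx expR d).
  apply: xget_subset1 => //.
  have : is_subset1 [set M : 'M[R[i]]_n | series u @ \oo --> M].
    by apply: cvg_mx_unique; exact: hausdorff_complex.
  by apply.
apply: cvg_mx => i j.
have -> : (fun k => series u k i j) =
    (fun x : R => x%:C *+ (i == j)) \o series (exp_coeff (d 0 j)).
  apply/funext => k; rewrite /series /= summxE rmorph_sum -sumrMnl.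
  apply: eq_bigr => l _; rewrite /u real_diagXn !mxE mulrnAr /exp_coeff /=.
  by rewrite mulrC -rmorphM; case: eqP => // ->.
have cexp : series (exp_coeff (d 0 j)) @ \oo --> expR (d 0 j).
  exact: is_cvg_series_exp_coeff.
have cont : continuous (fun x : R => x%:C *+ (i == j) : R[i]).
  by case: (i == j) => x; [exact: continuous_real_complex|exact: cvg_cst].
have -> : real_diag (map_mx expR d) i j = (expR (d 0 j))%:C *+ (i == j).
  by rewrite !mxE; case: eqP => // ->.
exact: (continuous_cvg _ (cont _) cexp).
Qed.

Lemma continuous_mulmx2 (A B : 'M[R[i]]_n) :
  continuous (fun X : 'M[R[i]]_n => A *m X *m B).
Proof.
have sumc (F : 'I_n -> 'M[R[i]]_n -> R[i]) :
    (forall k, continuous (F k)) -> continuous (fun X => \sum_k F k X).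
  move=> cF; apply: continuous_big => [|k _]; last exact: cF.
  exact: add_continuous.
apply: continuous_mx => i j; under eq_fun do rewrite mxE.
apply: (sumc) => k X.
have cAX : continuous (fun Y : 'M[R[i]]_n => (A *m Y) i k).
  under eq_fun do rewrite mxE.
  apply: (sumc) => l Y.
  exact: (continuous_cvg _ (@mulrl_continuous R[i] _ _)
                           (@continuous_entry _ _ _ _ _ Y)).
exact: (continuous_cvg _ (@mulrr_continuous R[i] _ _) (cAX X)).
Qed.

(** This reduces the exponential of a diagonalisable matrix to the diagonal
    case. *)
Lemma similarity_embedding P : P \in unitmx ->
  real_embedding (fun X => invmx P *m X *m P) (fun X => P *m X *m invmx P).
Proof.
move=> uP; split=> //; try exact: continuous_mulmx2.
- by move=> X; rewrite !mulmxA mulmxV // mul1mx mulmxK.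
- by move=> X Y; rewrite mulmxDr mulmxDl.
- by rewrite mulmx1 mulVmx.
- by move=> X Y; rewrite !mulmxA mulmxK.
- by move=> r X; rewrite -scalemxAr -scalemxAl.
Qed.

Lemma selfadjoint_diag X : selfadjoint R[i] n X ->
  exists2 P, P \in unitmx & exists d, X = invmx P *m real_diag d *m P.
Proof.
move=> sX.
have hX : X \is hermsymmx by apply/is_hermitianmxP; rewrite expr0 scale1r.
exists (spectralmx X); first exact: spectral_unit.
exists (map_mx (@complex.Re R) (spectral_diag X)).
have /orthomx_spectralP {1}-> := hermitian_normalmx hX.
congr (_ *m diag_mx _ *m _); apply/rowP => j; rewrite !mxE.
by rewrite RRe_real //; have /mxOverP := hermitian_spectral_diag_real hX; apply.
Qed.

(** The (i, j) entries compare [expR d_i * W_ij] with [W_ij * expR e_j]: where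
    [W] does not vanish, [d_i = e_j] because the real exponential is
    injective. *)
Lemma intertwine_expR (d e : 'rV[R]_n) (W : 'M[R[i]]_n) :
  real_diag (map_mx expR d) *m W = W *m real_diag (map_mx expR e) ->
  real_diag d *m W = W *m real_diag e.
Proof.
move=> WE; apply/matrixP => i j; move/matrixP: WE => /(_ i j).
rewrite !mul_diag_mx !mul_mx_diag !mxE mulrC.
have [->|W0] := eqVneq (W i j) 0; first by rewrite !(mul0r, mulr0).
by move=> /(mulfI W0)/complexI/expR_inj ->; rewrite mulrC.
Qed.

Lemma mxexp_injective_complex : mxexp_injective R[i] n.
Proof.
move=> X Y; rewrite !inE => /selfadjoint_diag[P uP [d ->]].
move=> /selfadjoint_diag[Q uQ [e ->]].
rewrite !(mxexp_embedding (similarity_embedding _)) ?mxexp_diag //;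
  try exact: hausdorff_complex.
by move/(similar_intertwine _ _ uP uQ)/intertwine_expR/
  (similar_intertwine _ _ uP uQ).
Qed.

End Hermitian.

(** A real symmetric matrix is a complex selfadjoint one. *)
Lemma mxexp_injective_real (R : realType) n :
  mxexp_injective (R : conjRingType R) n.
Proof.
pose f (X : 'M[R]_n) : 'M[R[i]]_n := map_mx (real_complex R) X.
pose g (Y : 'M[R[i]]_n) : 'M[R]_n := map_mx (@complex.Re R) Y.
apply: (@mxexp_injective_embedding R (R : conjRingType R) R[i] n n f g).
- exact: hausdorff_complex.
- split.
  + by move=> X; apply/matrixP => i j; rewrite !mxE.
  + apply: continuous_mx => i j; under eq_fun do rewrite mxE; move=> X.
    exact: (continuous_cvg _ (@continuous_real_complex R _)
                             (@continuous_entry _ _ _ i j X)).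
  + apply: continuous_mx => i j; under eq_fun do rewrite mxE; move=> X.
    exact: (continuous_cvg _ (@continuous_Re R _)
                             (@continuous_entry _ _ _ i j X)).
  + exact: map_mxD.
  + exact: map_mx1.
  + exact: map_mxM.
  + by move=> r X; rewrite /f map_mxZ.
- by move=> X; apply/matrixP => i j; rewrite !mxE; exact/esym/conjc_real.
- exact: mxexp_injective_complex.
Qed.

(** * Cayley-Dickson doublings *)

(** [D] is [E + E j] with [j ^ 2 = -1] and [j x = c x j], where [c] is the
    conjugation of [E], which is assumed to be a ring morphism; [p1] and [p2]
    are the two coordinates and [q] reassembles them. *)
Record doubling (R : realType) (D E : conjRingType R)
    (c : {rmorphism E -> E}) (p1 p2 : D -> E) (q : E * E -> D) : Prop :=
  Doubling {
  dbl_conj : @conjD R E = c;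
  dbl_conjK : involutive c;
  dbl_conj_real : forall r, c (realD r) = realD r;
  dbl_conj_continuous : continuous c;
  dbl_opp_continuous : continuous (-%R : E -> E);
  dbl1 : p1 1 = 1;
  dbl2 : p2 1 = 0;
  dbl1D : {morph p1 : x y / x + y};
  dbl2D : {morph p2 : x y / x + y};
  dbl1M : forall x y, p1 (x * y) = p1 x * p1 y - p2 x * c (p2 y);
  dbl2M : forall x y, p2 (x * y) = p1 x * p2 y + p2 x * c (p1 y);
  dbl1Z : forall r x, p1 (realD r * x) = realD r * p1 x;
  dbl2Z : forall r x, p2 (realD r * x) = realD r * p2 x;
  dbl1J : forall x, p1 (conjD x) = c (p1 x);
  dbl2J : forall x, p2 (conjD x) = - p2 x;
  dbl1_continuous : continuous p1;
  dbl2_continuous : continuous p2;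
  dblK : forall x, q (p1 x, p2 x) = x;
  dbl1V : forall z, p1 (q z) = z.1;
  dbl2V : forall z, p2 (q z) = z.2;
  dblV_continuous : continuous q }.

Section Doubling.
Variables (R : realType) (D E : conjRingType R).
Variables (c : {rmorphism E -> E}) (p1 p2 : D -> E) (q : E * E -> D).
Hypothesis dbl : doubling c p1 p2 q.
Variable n : nat.

Let Psi (X : 'M[D]_n) : 'M[E]_(n + n) :=
  block_mx (map_mx p1 X) (map_mx p2 X)
           (- map_mx c (map_mx p2 X)) (map_mx c (map_mx p1 X)).

Let Phi (Y : 'M[E]_(n + n)) : 'M[D]_n :=
  \matrix_(i, j) q (ulsubmx Y i j, ursubmx Y i j).

(** The automorphism [Y |-> J c(Y) J^-1], where [J] has blocks 0, 1, -1, 0 and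
    [c] acts on the entries; its fixed points are the image of [Psi]. *)
Let flip (Y : 'M[E]_(n + n)) : 'M[E]_(n + n) :=
  block_mx (map_mx c (drsubmx Y)) (- map_mx c (dlsubmx Y))
           (- map_mx c (ursubmx Y)) (map_mx c (ulsubmx Y)).

Let flipE (A B C F : 'M[E]_n) : flip (block_mx A B C F) =
  block_mx (map_mx c F) (- map_mx c C) (- map_mx c B) (map_mx c A).
Proof. by rewrite /flip block_mxKul block_mxKur block_mxKdl block_mxKdr. Qed.

Let mapcK (A : 'M[E]_n) : map_mx c (map_mx c A) = A.
Proof. by apply/matrixP => i j; rewrite !mxE (dbl_conjK dbl). Qed.

Let mapcZ r (A : 'M[E]_n) : map_mx c (realD r *: A) = realD r *: map_mx c A.
Proof. by rewrite map_mxZ; congr (_ *: _); apply: (dbl_conj_real dbl). Qed.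

Let ctrmxE p (A : 'M[E]_p) : ctrmx A = map_mx c A^T.
Proof. by rewrite /ctrmx (dbl_conj dbl). Qed.

Let mapcN (A : 'M[E]_n) : map_mx c (- A) = - map_mx c A.
Proof. exact: map_mxN. Qed.

Let p10 : p1 0 = 0.
Proof. by apply: (addrI (p1 0)); rewrite -(dbl1D dbl) !addr0. Qed.

Let p20 : p2 0 = 0.
Proof. by apply: (addrI (p2 0)); rewrite -(dbl2D dbl) !addr0. Qed.

Let map1M (X Y : 'M[D]_n) : map_mx p1 (X *m Y) =
  map_mx p1 X *m map_mx p1 Y - map_mx p2 X *m map_mx c (map_mx p2 Y).
Proof.
apply/matrixP => i j; rewrite !mxE -sumrB.
rewrite (big_morph p1 (dbl1D dbl) p10).
by apply: eq_bigr => k _; rewrite (dbl1M dbl) !mxE.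
Qed.

Let map2M (X Y : 'M[D]_n) : map_mx p2 (X *m Y) =
  map_mx p1 X *m map_mx p2 Y + map_mx p2 X *m map_mx c (map_mx p1 Y).
Proof.
apply/matrixP => i j; rewrite !mxE -big_split /=.
rewrite (big_morph p2 (dbl2D dbl) p20).
by apply: eq_bigr => k _; rewrite (dbl2M dbl) !mxE.
Qed.

Let continuous_opp_mx (T : topologicalType) (f : T -> 'M[E]_n) :
  continuous f -> continuous (fun t => - f t).
Proof.
move=> cf; have -> : (fun t => - f t) = fun t => map_mx -%R (f t).
  by apply/funext => t; apply/matrixP => i j; rewrite !mxE.
by apply: continuous_map_mx => //; apply: (dbl_opp_continuous dbl).
Qed.

Lemma Psi_embedding : real_embedding Psi Phi.
Proof.
have c1 := dbl1_continuous dbl; have c2 := dbl2_continuous dbl.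
have cc := dbl_conj_continuous dbl.
have [cul cur cdl cdr] := @continuous_submx E n.
have id_cont : continuous (id : 'M[D]_n -> 'M[D]_n) by move=> X; exact: cvg_id.
split.
- move=> X; apply/matrixP => i j.
  by rewrite /Phi /Psi mxE block_mxKul block_mxKur !mxE (dblK dbl).
- apply: continuous_block_mx; [|
    |apply: continuous_opp_mx; apply: continuous_map_mx => //
    |apply: continuous_map_mx => //]; exact: continuous_map_mx.
- apply: continuous_mx => i j; under eq_fun do rewrite mxE.
  have cV : continuous q by exact: (dblV_continuous dbl).
  move=> Y.
  have cYul : ulsubmx X i j @[X --> Y] --> ulsubmx Y i j.
    exact: (continuous_cvg _ (@continuous_entry _ _ _ i j _) (cul Y)).
  have cYur : ursubmx X i j @[X --> Y] --> ursubmx Y i j.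
    exact: (continuous_cvg _ (@continuous_entry _ _ _ i j _) (cur Y)).
  have cY : (ulsubmx X i j, ursubmx X i j) @[X --> Y] -->
            (ulsubmx Y i j, ursubmx Y i j) by exact: (cvg_pair cYul cYur).
  exact: (continuous_cvg _ (cV _) cY).
- move=> X Y; rewrite /Psi add_block_mx -!opprD -!map_mxD.
  congr block_mx; [|
    |congr (- map_mx _ _)
    |congr (map_mx _ _)]; apply/matrixP => i j; rewrite !mxE.
  + exact: (dbl1D dbl).
  + exact: (dbl2D dbl).
  + exact: (dbl2D dbl).
  + exact: (dbl1D dbl).
- rewrite /Psi [RHS]scalar_mx_block.
  have m1 : map_mx p1 (1%:M : 'M[D]_n) = 1%:M.
    by apply/matrixP => i j; rewrite !mxE; case: (i == j); rewrite ?(dbl1 dbl).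
  have m2 : map_mx p2 (1%:M : 'M[D]_n) = 0.
    by apply/matrixP => i j; rewrite !mxE; case: (i == j); rewrite ?(dbl2 dbl).
  by rewrite m1 m2 map_mx0 map_mx1 oppr0.
- move=> X Y; rewrite /Psi mulmx_block map1M map2M.
  rewrite !map_mxD !mapcN !map_mxM !mapcK; congr block_mx.
  + by rewrite mulmxN.
  + by rewrite opprD mulmxN mulNmx addrC.
  + by rewrite mulNmx addrC.
- move=> r X; rewrite /Psi scale_block_mx scalerN -!mapcZ.
  congr block_mx; [|
    |congr (- map_mx _ _)
    |congr (map_mx _ _)]; apply/matrixP => i j; rewrite !mxE.
  + exact: (dbl1Z dbl).
  + exact: (dbl2Z dbl).
  + exact: (dbl2Z dbl).
  + exact: (dbl1Z dbl).
Qed.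

Lemma Psi_ctrmx X : Psi (ctrmx X) = ctrmx (Psi X).
Proof.
rewrite ctrmxE /Psi tr_block_mx map_block_mx.
have e1 : map_mx p1 (ctrmx X) = map_mx c (map_mx p1 X)^T.
  by apply/matrixP => i j; rewrite !mxE (dbl1J dbl).
have e2 : map_mx p2 (ctrmx X) = - (map_mx p2 X)^T.
  by apply/matrixP => i j; rewrite !mxE (dbl2J dbl).
rewrite e1 e2; congr block_mx; apply/matrixP => i j; rewrite !mxE //.
- by rewrite rmorphN (dbl_conjK dbl).
- by rewrite rmorphN opprK.
Qed.

Lemma flipK : involutive flip.
Proof.
move=> Y; rewrite -(submxK Y) !flipE !mapcN !opprK !mapcK.
by rewrite submxK.
Qed.

Lemma flip_embedding : real_embedding flip flip.
Proof.
have cc := dbl_conj_continuous dbl.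
have [cul cur cdl cdr] := @continuous_submx E n.
have cflip : continuous flip.
  by apply: continuous_block_mx; try apply: continuous_opp_mx;
    apply: continuous_map_mx.
split=> //.
- exact: flipK.
- move=> X Y; rewrite -(submxK X) -(submxK Y) add_block_mx !flipE add_block_mx.
  by rewrite !map_mxD !opprD.
- by rewrite scalar_mx_block flipE map_mx0 map_mx1 oppr0.
- move=> X Y; rewrite -(submxK X) -(submxK Y) mulmx_block !flipE mulmx_block.
  rewrite !map_mxD !map_mxM !mulmxN !mulNmx !opprK !opprD.
  by congr block_mx; rewrite addrC.
- move=> r X; rewrite -(submxK X) scale_block_mx !flipE scale_block_mx.
  by rewrite !mapcZ !scalerN.
Qed.

Lemma flip_ctrmx Y : flip (ctrmx Y) = ctrmx (flip Y).
Proof.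
rewrite -(submxK Y) !ctrmxE !flipE !tr_block_mx !map_block_mx flipE.
by congr block_mx; apply/matrixP => i j; rewrite !mxE ?rmorphN.
Qed.

Lemma flip_Psi X : flip (Psi X) = Psi X.
Proof. by rewrite /Psi flipE mapcN !mapcK opprK. Qed.

Lemma Psi_flip_fix Y : flip Y = Y -> Psi (Phi Y) = Y.
Proof.
move=> flipY.
have P1 : map_mx p1 (Phi Y) = ulsubmx Y.
  by apply/matrixP => i j; rewrite !mxE (dbl1V dbl).
have P2 : map_mx p2 (Phi Y) = ursubmx Y.
  by apply/matrixP => i j; rewrite !mxE (dbl2V dbl).
have : flip Y = block_mx (ulsubmx Y) (ursubmx Y) (dlsubmx Y) (drsubmx Y).
  by rewrite submxK.
move=> /eq_block_mx[_ _ dlE drE].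
by rewrite /Psi P1 P2 dlE drE submxK.
Qed.

Lemma doubling_log_bar k (w : 'I_k -> R) (A : 'I_k -> 'M[D]_n) :
  hausdorff_space E -> mxexp_injective E (n + n) ->
  Psi (log_bar w A) = log_bar w (fun j => Psi (A j)).
Proof.
move=> hE inj; exact: (log_bar_embedding hE Psi_embedding Psi_ctrmx
  flip_embedding flip_ctrmx flip_Psi Psi_flip_fix inj).
Qed.

End Doubling.

Lemma complex_doubling (R : realType) :
  doubling (E := (R : conjRingType R)) (idfun : {rmorphism R -> R})
    (@complex.Re R : R[i] -> R) (@complex.Im R) (fun z => z.1 +i* z.2).
Proof.
split=> //.
- by move=> x; exact: cvg_id.
- exact: oppr_continuous.
- exact: raddfD.
- exact: raddfD.
- by move=> [a b] [a' b'].
- by move=> [a b] [a' b'].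
- by move=> r [a b] /=; rewrite mul0r subr0.
- by move=> r [a b] /=; rewrite mul0r addr0.
- by move=> [a b].
- by move=> [a b].
- exact: continuous_Re.
- exact: continuous_Im.
- by case.
- exact: continuous_Complex.
Qed.

Lemma quaternion_doubling (R : realType) :
  doubling (D := quaternion R) (E := R[i]) (@conjc R : {rmorphism R[i] -> R[i]})
    (fun x => x.1) (fun x => x.2) id.
Proof.
split=> //.
- exact: conjcK.
- exact: conjc_real.
- exact: continuous_conjc.
- exact: oppr_continuous.
- by move=> r [a b] /=; rewrite mul0r subr0.
- by move=> r [a b] /=; rewrite mul0r addr0.
- by move=> x; exact: cvg_fst.
- by move=> x; exact: cvg_snd.
- by case.
- by move=> x; exact: cvg_id.
Qed.

(** * The barycentre identities *)

Theorem corollary4p7 (R : realType) (n m k : nat)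
    (hn : (1 <= n)%N) (hm : (1 <= m)%N) (hk : (1 <= k)%N)
    (A : 'I_k -> 'M[R[i]]_n) (B : 'I_k -> 'M[quaternion R]_m) (w : 'I_k -> R)
    (hA : forall j, posdef R[i] n (A j))
    (hB : forall j, posdef (quaternion R) m (B j))
    (hw : forall j, 0 < w j) (hw1 : \sum_(j < k) w j = 1) :
  Psi1 (log_bar w A) = log_bar w (fun j => Psi1 (A j)) /\
  Psi2 (log_bar w B) = log_bar w (fun j => Psi2 (B j)).
Proof.
split.
(* The conjugation of the reals is the identity, which Psi1 leaves out. *)
- have Psi1E (X : 'M[R[i]]_n) : Psi1 X =
      block_mx (map_mx (@complex.Re R) X) (map_mx (@complex.Im R) X)
        (- map_mx idfun (map_mx (@complex.Im R) X))
        (map_mx idfun (map_mx (@complex.Re R) X)).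
    by rewrite !map_mx_id.
  under [in RHS]eq_fun do rewrite Psi1E.
  rewrite Psi1E; apply: (doubling_log_bar (complex_doubling R)).
    exact: norm_hausdorff.
  exact: mxexp_injective_real.
- apply: (doubling_log_bar (quaternion_doubling R)).
    exact: hausdorff_complex.
  exact: mxexp_injective_complex.
Qed.
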